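(* Let $A$ be a real $q\times p$ matrix with $\ker(A)=\ker(X)$, and assume that Assumption $H(A'A,3)$ is satisfied, with constant $c(A'A)>0$. Let $0<\eta<1$ and $\lambda = 2\sigma\sqrt{2n\log(p/\eta)}$. Let $\hat\beta_{A,\lambda}$ be a minimizer over $\beta\in\mathbb{R}^p$ of $$-2Y'X(\widetilde{X'X})^{-1}(A'A)\beta+\beta'(A'A)\beta+2\lambda\|\Xi_A\beta\|_1 .$$ Then, with probability at least $1-\eta$ on the draw of $Y$, we have simultaneously $$\left\|A\left(\hat\beta_{A,\lambda}-\beta^*\right)\right\|_2^2\le \frac{72\sigma^2}{c(A'A)}\log\left(\frac{p}{\eta}\right)\sum_{j:\beta^*_j\ne 0}\xi_j(A)$$ and $$\left\|\Xi_A\left(\hat\beta_{A,\lambda}-\beta^*\right)\right\|_1\le \frac{24\sqrt2\,\sigma}{c(A'A)}\left(\frac{\log(p/\eta)}{n}\right)^{1/2}\sum_{j:\beta^*_j\ne 0}\xi_j(A).$$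
   Context: Model: $Y=X\beta^*+\varepsilon$, where $X$ is a deterministic real $n\times p$ matrix with columns $X_1,\dots,X_p$ normalized so that $X_j'X_j/n=1$ for every $j$ (possibly $p>n$), $\beta^*\in\mathbb{R}^p$ is unknown, and $\varepsilon=(\varepsilon_1,\dots,\varepsilon_n)'$ has i.i.d. $\mathcal{N}(0,\sigma^2)$ coordinates with known variance $\sigma^2$. A prime denotes transposition; $\|\cdot\|_1,\|\cdot\|_2$ are the usual $\ell_1$ and Euclidean norms. $(\widetilde{X'X})^{-1}$ denotes $(X'X)^{-1}$ if $X'X$ is invertible, and any (fixed) pseudo-inverse of $X'X$ otherwise. For a $q\times p$ matrix $A$ with $\ker(A)=\ker(X)$ and $1\le j\le p$, $$\xi_j(A)=\frac1n\left[(A'A)(\widetilde{X'X})^{-1}(A'A)\right]_{j,j},$$ and $\Xi_A$ is the $p\times p$ diagonal matrix whose $(j,j)$-th coefficient is $\xi_j^{1/2}(A)$. Assumption $H(A'A,x)$, for $x>0$: there is a constant $c(A'A)>0$ such that for every $\alpha\in\mathbb{R}^p$ with $$\sum_{j:\beta_j^*=0}\xi_j^{1/2}(A)|\alpha_j|\le x\sum_{j:\beta_j^*\ne0}\xi_j^{1/2}(A)|\alpha_j|$$ one has $\alpha'(A'A)\alpha\ge c(A'A)\,n\sum_{j:\beta_j^*\neq0}\alpha_j^2$. *)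

(* Defs.v *)
From HB Require Import structures.
From mathcomp Require Import all_boot all_order all_algebra.
From mathcomp Require Import all_classical all_reals all_analysis.

Set Implicit Arguments.
Unset Strict Implicit.
Unset Printing Implicit Defensive.

Import Order.TTheory GRing.Theory Num.Theory.
Local Open Scope classical_set_scope.
Local Open Scope ring_scope.

(* The norm that mathcomp-analysis puts on matrices is the sup norm, whence the
   explicit l1 and l2 norms below. *)
Definition l1norm (R : realType) (m : nat) (v : 'cV[R]_m) : R :=
  \sum_(i < m) `|v i 0|.

Definition l2norm (R : realType) (m : nat) (v : 'cV[R]_m) : R :=
  Num.sqrt (\sum_(i < m) v i 0 ^+ 2).

(* Kernel acting on column vectors; the library's kermx is the row kernel. *)
Definition ker (R : realType) (m p : nat) (M : 'M[R]_(m, p)) : set 'cV[R]_p :=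
  [set v | M *m v = 0].

Definition gram (R : realType) (m p : nat) (M : 'M[R]_(m, p)) : 'M[R]_p :=
  M^T *m M.

(* G is the inverse of M when M is invertible and otherwise some pseudo-inverse
   of M.  Pseudo-inverses are not unique here, so this is the generalized
   inverse M G M = M and not the Moore-Penrose inverse, which is a special
   case of it. *)
Definition tilde_inverse (R : realType) (p : nat) (M G : 'M[R]_p) : Prop :=
  if M \in unitmx then G = invmx M else M *m G *m M = M.

(* In what follows G stands for the fixed (pseudo-)inverse of X'X. *)
Definition xi (R : realType) (n p q : nat) (G : 'M[R]_p) (A : 'M[R]_(q, p))
    (j : 'I_p) : R :=
  n%:R^-1 * (gram A *m G *m gram A) j j.

Definition Xi (R : realType) (n p q : nat) (G : 'M[R]_p) (A : 'M[R]_(q, p)) :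
    'M[R]_p :=
  diag_mx (\row_j Num.sqrt (xi n G A j)).

(* Assumption H(A'A, x), with c the constant c(A'A). *)
Definition assumption_H (R : realType) (n p q : nat) (beta : 'cV[R]_p)
    (G : 'M[R]_p) (A : 'M[R]_(q, p)) (x c : R) : Prop :=
  0 < c /\
  forall alpha : 'cV[R]_p,
    \sum_(j < p | beta j 0 == 0) Num.sqrt (xi n G A j) * `|alpha j 0|
      <= x * \sum_(j < p | beta j 0 != 0) Num.sqrt (xi n G A j) * `|alpha j 0| ->
    c * n%:R * \sum_(j < p | beta j 0 != 0) alpha j 0 ^+ 2
      <= (alpha^T *m gram A *m alpha) 0 0.

Definition objective (R : realType) (n p q : nat) (X : 'M[R]_(n, p))
    (G : 'M[R]_p) (A : 'M[R]_(q, p)) (lambda : R) (Y : 'cV[R]_n)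
    (beta : 'cV[R]_p) : R :=
  - 2 * (Y^T *m X *m G *m gram A *m beta) 0 0
  + (beta^T *m gram A *m beta) 0 0
  + 2 * lambda * l1norm (Xi n G A *m beta).

Definition is_minimizer (R : realType) (p : nat) (f : 'cV[R]_p -> R)
    (b : 'cV[R]_p) : Prop :=
  forall b' : 'cV[R]_p, f b <= f b'.

Definition independent_RVs (d : measure_display) (T : measurableType d)
    (R : realType) (P : probability T R) (n : nat)
    (eps : 'I_n -> {RV P >-> R}) : Prop :=
  forall (J : {set 'I_n}) (B : 'I_n -> set R),
    (forall i, measurable (B i)) ->
    P (\bigcap_(i in [set` J]) (eps i @^-1` B i))
      = (\prod_(i in J) P (eps i @^-1` B i))%E.

(* normal_prob m s has standard deviation s, i.e., variance s ^+ 2. *)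
Definition iid_normal (d : measure_display) (T : measurableType d)
    (R : realType) (P : probability T R) (n : nat)
    (eps : 'I_n -> {RV P >-> R}) (sigma : R) : Prop :=
  independent_RVs eps /\
  forall (i : 'I_n) (B : set R), measurable B ->
    distribution P (eps i) B = normal_prob 0 sigma B.

(* S need not be measurable, since it may depend on an arbitrary selection of
   minimizers; it is required to contain a measurable event of probability at
   least r.  For measurable S this is equivalent to r <= P(S). *)
Definition holds_with_prob_ge (d : measure_display) (T : measurableType d)
    (R : realType) (P : probability T R) (r : R) (S : set T) : Prop :=
  exists E : set T, [/\ measurable E, E `<=` S & (r%:E <= P E)%E].

(* Main.v *)
Require Import Defs.
From HB Require Import structures.
From mathcomp Require Import all_boot all_order all_algebra.
From mathcomp Require Import all_classical all_reals all_analysis.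
From mathcomp Require Import measurable_realfun ring lra.

Import Order.TTheory GRing.Theory Num.Theory.
Local Open Scope classical_set_scope.
Local Open Scope ring_scope.

(** Write M = A'A and Z = X G M. Since A and X have the same kernel, M factors
    through X'X, and this turns every appearance of the pseudo-inverse into an
    honest Gram matrix: X'Z = M, and n xi_j is the squared Euclidean norm of
    the j-th column Z_j of Z ([linear_noise_design], [xiE]). With b0 the true
    coefficient vector and Y = X b0 + eps, the criterion becomes, up to a
    constant, the quadratic form of M at beta - b0 minus twice the noise term
    W'beta plus the penalty, where W_j = Z_j'eps is a centred Gaussian of
    variance sigma^2 n xi_j.

    Deterministic part. If |W_j| <= (lambda / 2) xi_j^(1/2) for every j, half
    of the penalty dominates the noise. Comparing the minimizer with b0 then
    gives, for D the squared l2 norm of A (betahat - b0), for N the weighted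
    l1 norm of the error and for s the part of N carried by the support of b0,
    D + lambda N <= 4 lambda s ([cone_inequality]). This places the error in
    the cone of the restricted eigenvalue assumption, which bounds the squared
    l2 norm of the error on the support by D / (c n), and the arithmetic-
    geometric mean inequality closes the loop ([cone_prediction_l1_bounds]).

    Probabilistic part. The value of lambda makes the threshold for W_j equal
    to (2 log (p / eta))^(1/2) standard deviations, and a union bound over the
    p coordinates requires each of them to exceed it with probability at most
    eta / p. Exponential moments lose a factor 2 here, one for each tail; the
    two-sided bound P(|N(0, s^2)| > t) <= exp (- t^2 / (2 s^2)) is obtained
    instead by translating each half-line tail back to the origin
    ([normal_prob_tail]). It is a statement about an exact Gaussian law, so
    the law of Z_j'eps has to be identified. This is done by adding one
    coordinate at a time ([normal_linear_combination]), each addition being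
    the rotation invariance of the planar Gaussian measure
    ([normal_prob_rotate]). *)

(** * Gram matrices and the pseudo-inverse *)

Lemma gramE (R : realType) (m p : nat) (B : 'M[R]_(m, p)) (j : 'I_p) :
  gram B j j = \sum_(i < m) B i j ^+ 2.
Proof. by rewrite /gram mxE; apply: eq_bigr => i _; rewrite mxE expr2. Qed.

Lemma gram_eq0 (R : realType) (m p : nat) (B : 'M[R]_(m, p)) :
  gram B = 0 -> B = 0.
Proof.
move=> B0; apply/matrixP => i j; rewrite mxE; apply/eqP.
have /eqP : \sum_(k < m) B k j ^+ 2 = 0 by rewrite -gramE B0 mxE.
rewrite psumr_eq0 => [/allP/(_ i)|k _]; last exact: sqr_ge0.
by rewrite mem_index_enum sqrf_eq0 => /(_ isT).
Qed.

Lemma trmx_gram (R : realType) (m p : nat) (B : 'M[R]_(m, p)) :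
  (gram B)^T = gram B.
Proof. by rewrite /gram trmx_mul trmxK. Qed.

Lemma l2norm_mul (R : realType) (m p : nat) (B : 'M[R]_(m, p)) (v : 'cV[R]_p) :
  l2norm (B *m v) ^+ 2 = (v^T *m gram B *m v) 0 0.
Proof.
rewrite /l2norm sqr_sqrtr ?sumr_ge0// => [|i _]; last exact: sqr_ge0.
by rewrite -gramE /gram trmx_mul !mulmxA.
Qed.

(** If B'BC = 0 then (BC)'(BC) = C'(B'BC) = 0, and a real matrix with zero Gram
    matrix is zero. *)
Lemma gram_mul_eq0 (R : realType) (m p k : nat) (B : 'M[R]_(m, p))
    (C : 'M[R]_(p, k)) : gram B *m C = 0 -> B *m C = 0.
Proof.
move=> BC0; apply: gram_eq0.
by rewrite /gram trmx_mul -mulmxA [B^T *m _]mulmxA -/(gram B) BC0 mulmx0.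
Qed.

(** The generalized inverse equation reads X'X (G X'X - 1) = 0, and X'X may be
    replaced by X on the left. *)
Lemma mul_tilde_inverse (R : realType) (n p : nat) (X : 'M[R]_(n, p))
    (G : 'M[R]_p) :
  tilde_inverse (gram X) G -> X *m G *m gram X = X.
Proof.
move=> hG; have SGS : gram X *m G *m gram X = gram X.
  move: hG; rewrite /tilde_inverse; case: ifP => [Xu ->|_ //].
  by rewrite mulmxV// mul1mx.
apply/eqP; rewrite -subr_eq0; apply/eqP.
rewrite -[X in _ - X]mulmx1 -mulmxA -mulmxBr; apply: gram_mul_eq0.
by rewrite mulmxBr mulmx1 mulmxA SGS subrr.
Qed.

(** The columns of the cokernel of X'X span the kernel of X, hence lie in the
    kernel of A; so A'A vanishes on them, which is inclusion of row spaces.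
    The factorization by columns follows since both Gram matrices are
    symmetric. *)
Lemma gram_factor (R : realType) (n p q : nat) (X : 'M[R]_(n, p))
    (A : 'M[R]_(q, p)) :
  ker A = ker X -> exists K : 'M[R]_p, gram A = gram X *m K.
Proof.
move=> hA.
suff /submxP[D AD] : (gram A <= gram X)%MS.
  by exists D^T; rewrite -[LHS]trmx_gram AD trmx_mul trmx_gram.
rewrite submxE; apply/eqP.
have XC0 : X *m cokermx (gram X) = 0 by apply: gram_mul_eq0; exact: mulmx_coker.
have AC0 : A *m cokermx (gram X) = 0.
  apply/matrixP => i j; rewrite [RHS]mxE.
  have : ker X (col j (cokermx (gram X))).
    by rewrite /ker/= colE mulmxA XC0 mul0mx.
  rewrite -hA /ker/= colE mulmxA -colE => /matrixP/(_ i 0).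
  by rewrite !mxE.
by rewrite /gram -mulmxA AC0 mulmx0.
Qed.

(** With A'A = X'X K one has Z = X K: the choice of pseudo-inverse disappears.
    The first identity makes the true vector the centre of the quadratic
    criterion; the second one identifies xi_j with the variance factor of the
    noise in coordinate j. *)
Lemma linear_noise_design (R : realType) (n p q : nat) (X : 'M[R]_(n, p))
    (G : 'M[R]_p) (A : 'M[R]_(q, p)) (Z := X *m G *m gram A) :
  tilde_inverse (gram X) G -> ker A = ker X ->
  X^T *m Z = gram A /\ gram Z = gram A *m G *m gram A.
Proof.
move=> hG /gram_factor[K AK].
have ZK : Z = X *m K by rewrite /Z AK mulmxA mul_tilde_inverse.
have XZ : X^T *m Z = gram A by rewrite ZK AK mulmxA.
have AKT : gram A = K^T *m gram X by rewrite -trmx_gram AK trmx_mul trmx_gram.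
split=> //; rewrite /(gram Z) {1}ZK trmx_mul [X in _ = X *m _ *m _]AKT.
by rewrite /Z /(gram X) !mulmxA.
Qed.

Lemma xiE (R : realType) (n p q : nat) (X : 'M[R]_(n, p))
    (G : 'M[R]_p) (A : 'M[R]_(q, p)) (j : 'I_p) :
  tilde_inverse (gram X) G -> ker A = ker X ->
  xi n G A j = n%:R^-1 * \sum_(i < n) (X *m G *m gram A) i j ^+ 2.
Proof.
by move=> hG hA; rewrite /xi -(linear_noise_design _ _ _ _ _ _ _ hG hA).2 gramE.
Qed.

Lemma xi_ge0 (R : realType) (n p q : nat) (X : 'M[R]_(n, p))
    (G : 'M[R]_p) (A : 'M[R]_(q, p)) (j : 'I_p) :
  tilde_inverse (gram X) G -> ker A = ker X -> 0 <= xi n G A j.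
Proof.
move=> hG hA; rewrite (xiE _ _ _ _ X)// mulr_ge0 ?invr_ge0 ?ler0n//.
by rewrite sumr_ge0// => i _; exact: sqr_ge0.
Qed.

(** * The deterministic oracle inequality *)

(** Y'XGM = Y'Z = b0'M + e'Z, where b0 is betastar, so completing the square
    turns the criterion into the quadratic form of M at b - b0 minus twice
    e'Z b plus the penalty; its values at the minimizer and at b0 are then
    compared. *)
Lemma minimizer_basic_inequality (R : realType) (n p q : nat) (X : 'M[R]_(n, p))
    (betastar b : 'cV[R]_p) (e Y : 'cV[R]_n)
    (G : 'M[R]_p) (A : 'M[R]_(q, p)) (lambda : R) (Z := X *m G *m gram A) :
  tilde_inverse (gram X) G -> ker A = ker X -> Y = X *m betastar + e ->
  is_minimizer (objective X G A lambda Y) b ->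
  l2norm (A *m (b - betastar)) ^+ 2 + 2 * lambda * l1norm (Xi n G A *m b)
   <= 2 * (e^T *m Z *m (b - betastar)) 0 0
      + 2 * lambda * l1norm (Xi n G A *m betastar).
Proof.
move=> hG hA YE /(_ betastar).
have [XZ _] := linear_noise_design _ _ _ _ _ _ _ hG hA.
rewrite -/Z in XZ; rewrite l2norm_mul.
(* The error is generalized, lest distributing products over sums unfold it. *)
set d := b - betastar; have -> : b = betastar + d by rewrite addrC subrK.
clearbody d.
have YZ : Y^T *m X *m G *m gram A = betastar^T *m gram A + e^T *m Z.
  rewrite (_ : _ *m gram A = Y^T *m Z); last by rewrite /Z !mulmxA.
  by rewrite YE raddfD/= mulmxDl trmx_mul -(mulmxA _ X^T) XZ.
have sym : (d^T *m gram A *m betastar) 0 0 = (betastar^T *m gram A *m d) 0 0.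
  transitivity ((d^T *m gram A *m betastar)^T 0 0); first by rewrite [RHS]mxE.
  by rewrite trmx_mul (trmx_mul d^T) trmxK trmx_gram mulmxA.
rewrite /objective YZ [(betastar + d)^T]raddfD/= !(mulmxDl, mulmxDr).
have addE (u v : 'M[R]_1) : (u + v) 0 0 = u 0 0 + v 0 0 by rewrite mxE.
by rewrite !addE sym; lra.
Qed.

Lemma l1norm_Xi (R : realType) (n p q : nat) (G : 'M[R]_p) (A : 'M[R]_(q, p))
    (b : 'cV[R]_p) :
  l1norm (Xi n G A *m b) = \sum_(j < p) Num.sqrt (xi n G A j) * `|b j 0|.
Proof.
apply: eq_bigr => j _.
by rewrite /Xi mul_diag_mx !mxE normrM ger0_norm ?sqrtr_ge0.
Qed.

(** The noise costs at most lambda times the weighted norm of the error.  Adding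
    that norm once more on both sides, a coordinate outside the support of bs
    contributes |bs_j| - |b_j| + |b_j - bs_j| = 0 to the right-hand side, and
    one in the support at most 2 |b_j - bs_j|. *)
Lemma cone_inequality (R : realType) (p : nat) (w : 'I_p -> R)
    (bs b W : 'I_p -> R) (D lambda : R) :
  (forall j, 0 <= w j) -> 0 <= lambda ->
  (forall j, `|W j| <= lambda / 2 * w j) ->
  D + 2 * lambda * (\sum_(j < p) w j * `|b j|)
    <= 2 * (\sum_(j < p) W j * (b j - bs j))
       + 2 * lambda * (\sum_(j < p) w j * `|bs j|) ->
  D + lambda * (\sum_(j < p) w j * `|b j - bs j|)
    <= 4 * lambda * (\sum_(j < p | bs j != 0) w j * `|b j - bs j|).
Proof.
move=> w0 l0 hW.
have noise : 2 * (\sum_(j < p) W j * (b j - bs j))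
    <= lambda * (\sum_(j < p) w j * `|b j - bs j|).
  rewrite !mulr_sumr; apply: ler_sum => j _.
  have : W j * (b j - bs j) <= lambda / 2 * w j * `|b j - bs j|.
    rewrite (le_trans (ler_norm _))// normrM ler_wpM2r//.
  by lra.
have tri : 2 * lambda * (\sum_(j < p) w j * `|bs j|)
      - 2 * lambda * (\sum_(j < p) w j * `|b j|)
      + 2 * lambda * (\sum_(j < p) w j * `|b j - bs j|)
   <= 4 * lambda * (\sum_(j < p | bs j != 0) w j * `|b j - bs j|).
  rewrite [in leRHS]big_mkcond/= !mulr_sumr -sumrB -big_split/=.
  apply: ler_sum => j _; rewrite -!mulrA -!mulrBr -!mulrDr.
  have [->|_] /= := eqVneq (bs j) 0; first by rewrite normr0 subr0; lra.
  have /= := ler_normB (b j) (b j - bs j); rewrite subKr => h.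
  have := mulr_ge0 l0 (w0 j); nra.
by lra.
Qed.

(** Dropping D from the hypothesis gives the cone condition with constant 3, so
    the restricted eigenvalue bound applies.  Then if s is the weighted
    norm of the error on S and N the one over all coordinates, the
    arithmetic-geometric mean inequality reads
    2 m s <= (m^2 / k) sum w_j^2 + D for every m.  The bound on D comes from
    m = 3 lambda and D <= 3 lambda s, the one on N from m = 2 lambda and
    D + lambda N <= 4 lambda s. *)
Lemma cone_prediction_l1_bounds (R : realType) (p : nat) (S : pred 'I_p)
    (w u : 'I_p -> R) (D lambda k : R) :
  (forall j, 0 <= w j) -> (forall j, 0 <= u j) -> 0 < lambda -> 0 < k ->
  0 <= D ->
  D + lambda * (\sum_(j < p) w j * u j)
    <= 4 * lambda * (\sum_(j < p | S j) w j * u j) ->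
  (\sum_(j < p | ~~ S j) w j * u j <= 3 * \sum_(j < p | S j) w j * u j ->
   k * \sum_(j < p | S j) u j ^+ 2 <= D) ->
  D <= 9 * lambda ^+ 2 / k * (\sum_(j < p | S j) w j ^+ 2) /\
  \sum_(j < p) w j * u j <= 4 * lambda / k * (\sum_(j < p | S j) w j ^+ 2).
Proof.
move=> w0 u0 l0 k0 D0; rewrite [\sum_(j < p) _](bigID S)/=.
set s := \sum_(j < p | S j) w j * u j.
set t := \sum_(j < p | ~~ S j) w j * u j => cone RE.
have t0 : 0 <= t by rewrite sumr_ge0// => j _; rewrite mulr_ge0.
have {}RE : k * \sum_(j < p | S j) u j ^+ 2 <= D.
  by apply: RE; rewrite -(ler_pM2l l0); lra.
have amgm (m : R) : 2 * m * s <=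
    m ^+ 2 / k * (\sum_(j < p | S j) w j ^+ 2) + k * \sum_(j < p | S j) u j ^+ 2.
  rewrite !mulr_sumr -big_split/=; apply: ler_sum => j _.
  rewrite -subr_ge0.
  rewrite (_ : _ - _ = (m * w j - k * u j) ^+ 2 / k); last by field; lra.
  by rewrite divr_ge0 ?sqr_ge0// ltW.
split.
(* Here 2 D <= 6 lambda s; one D is left after cancelling the bound D on the
   squared error. *)
  by have := amgm (3 * lambda); rewrite exprMn; have := mulr_ge0 (ltW l0) t0; lra.
rewrite -(ler_pM2l l0); have := amgm (2 * lambda); rewrite exprMn expr2.
set x := \sum_(_ < _ | _) _; set y := \sum_(_ < _ | _) _ in RE *.
have -> : lambda * (4 * lambda / k * x) = 2 ^+2 * (lambda * lambda) / k * x by ring.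
by lra.
Qed.

(** No randomness is left: on the event that the noise is dominated by half of
    the penalty, the error bounds hold for every minimizer. *)
Lemma oracle_inequality (R : realType) (n p q : nat) (X : 'M[R]_(n, p))
    (betastar b : 'cV[R]_p) (e Y : 'cV[R]_n)
    (G : 'M[R]_p) (A : 'M[R]_(q, p)) (lambda c : R) (Z := X *m G *m gram A) :
  (0 < n)%N -> 0 < lambda ->
  tilde_inverse (gram X) G -> ker A = ker X -> Y = X *m betastar + e ->
  assumption_H n betastar G A 3 c ->
  (forall j, `|\sum_(i < n) Z i j * e i 0|
               <= lambda / 2 * Num.sqrt (xi n G A j)) ->
  is_minimizer (objective X G A lambda Y) b ->
  l2norm (A *m (b - betastar)) ^+ 2
    <= 9 * lambda ^+ 2 / (c * n%:R) * (\sum_(j < p | betastar j 0 != 0) xi n G A j)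
  /\
  l1norm (Xi n G A *m (b - betastar))
    <= 4 * lambda / (c * n%:R) * (\sum_(j < p | betastar j 0 != 0) xi n G A j).
Proof.
move=> n_gt0 lam0 hG hA hY [c0 hRE] hW bmin.
set D := l2norm _ ^+ 2; set del := b - betastar in D *.
have cone := minimizer_basic_inequality _ _ _ _ _ _ _ _ _ _ _ _ hG hA hY bmin.
rewrite !l1norm_Xi -/D in cone.
have := cone_inequality _ _ (fun j => Num.sqrt (xi n G A j))
  (fun j => betastar j 0) (fun j => b j 0)
  (fun j => \sum_(i < n) Z i j * e i 0) D lambda (fun j => sqrtr_ge0 _)
  (ltW lam0) hW.
have noiseE : 2 * (e^T *m Z *m del) 0 0 =
    2 * \sum_(j < p) (\sum_(i < n) Z i j * e i 0) * (b j 0 - betastar j 0).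
  rewrite mxE; congr (_ * _); apply: eq_bigr => j _; rewrite !mxE; congr (_ * _).
  by apply: eq_bigr => i _; rewrite !mxE mulrC.
rewrite -noiseE => /(_ cone) basic.
have RE : \sum_(j < p | ~~ (betastar j 0 != 0)) Num.sqrt (xi n G A j) * `|del j 0|
    <= 3 * \sum_(j < p | betastar j 0 != 0) Num.sqrt (xi n G A j) * `|del j 0| ->
    c * n%:R * (\sum_(j < p | betastar j 0 != 0) `|del j 0| ^+ 2) <= D.
  move=> dcone; rewrite (_ : D = (del^T *m gram A *m del) 0 0); last first.
    exact: l2norm_mul.
  under eq_bigr do rewrite real_normK ?num_real//.
  by apply: hRE; under eq_bigl do rewrite -[_ == _]negbK.
have delE (Q : pred 'I_p) :
    \sum_(j < p | Q j) Num.sqrt (xi n G A j) * `|b j 0 - betastar j 0|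
    = \sum_(j < p | Q j) Num.sqrt (xi n G A j) * `|del j 0|.
  by apply: eq_bigr => j _; rewrite !mxE.
rewrite !delE in basic.
have sqE : \sum_(j < p | betastar j 0 != 0) Num.sqrt (xi n G A j) ^+ 2
    = \sum_(j < p | betastar j 0 != 0) xi n G A j.
  by apply: eq_bigr => j _; rewrite sqr_sqrtr ?(xi_ge0 _ _ _ _ X).
have cn0 : 0 < c * n%:R by rewrite mulr_gt0 ?ltr0n.
rewrite -sqE l1norm_Xi.
exact: (cone_prediction_l1_bounds _ _ _ _ (fun j => `|del j 0|) _ _ _
  (fun j => sqrtr_ge0 _) (fun j => normr_ge0 _) lam0 cn0 (sqr_ge0 _) basic RE).
Qed.

(** * Affine changes of variable and Gaussian integrals *)

Lemma measurable_affine (R : realType) (a b : R) :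
  measurable_fun [set: R] (fun x : R => a * x + b).
Proof. by apply: measurable_funD => //; exact: measurable_funM. Qed.

(** Both sides are measures in B, so intervals suffice.  For a < 0 the preimage
    of an interval open on the left is open on the right instead. *)
Lemma lebesgue_measure_affine (R : realType) (a b : R) (B : set R) :
  a != 0 -> measurable B ->
  lebesgue_measure B
    = (`|a|%:E * lebesgue_measure [set x : R | B (a * x + b)%R])%E.
Proof.
move=> a0 mB.
pose g : R -> measurableTypeR R := fun x => a * x + b.
have mg : measurable_fun setT g by exact: measurable_affine.
pose k : {nonneg R} := NngNum (normr_ge0 a).
have := @lebesgue_measure_unique R (mscale k (pushforward lebesgue_measure g)).
apply => // _ [[u v]] _ <- /=.
rewrite /mscale/= /pushforward lebesgue_measure_itv/= lte_fin.
have [a_gt0|a_le0] := ltrP 0 a.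
  rewrite (_ : _ @^-1` _ = `](u - b) / a, (v - b) / a]%classic); last first.
    apply/seteqP; split=> x /=; rewrite !in_itv/= /g => /andP[].
      by move=> ux xv; rewrite ltr_pdivrMr// ler_pdivlMr//; lra.
    by rewrite ltr_pdivrMr// ler_pdivlMr// => ux xv; lra.
  rewrite lebesgue_measure_itv/= lte_fin ltr_pM2r ?invr_gt0// ltrD2r.
  case: ifPn => _; last by rewrite mule0.
  by rewrite -!EFinD -EFinM gtr0_norm//; congr EFin; field.
have a_lt0 : a < 0 by rewrite lt_neqAle a0.
rewrite (_ : _ @^-1` _ = `[(v - b) / a, (u - b) / a[%classic); last first.
  apply/seteqP; split=> x /=; rewrite !in_itv/= /g => /andP[].
    by move=> ux xv; rewrite ler_ndivrMr// ltr_ndivlMr//; lra.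
  by rewrite ler_ndivrMr// ltr_ndivlMr// => ux xv; lra.
rewrite lebesgue_measure_itv/= lte_fin ltr_nM2r ?invr_lt0// ltrD2r.
case: ifPn => _; last by rewrite mule0.
by rewrite -!EFinD -EFinM ltr0_norm//; congr EFin; field.
Qed.

Lemma ge0_integral_affine (R : realType) (a b : R) (f : R -> \bar R) :
  a != 0 -> measurable_fun setT f -> (forall x, 0 <= f x)%E ->
  (\int[lebesgue_measure]_x f x
    = `|a|%:E * \int[lebesgue_measure]_x f (a * x + b)%R)%E.
Proof.
move=> a0 mf f0.
pose g : measurableTypeR R -> measurableTypeR R := fun x => a * x + b.
have mg : measurable_fun setT g by exact: measurable_affine.
pose k : {nonneg R} := NngNum (normr_ge0 a).
pose nu : {measure set (measurableTypeR R) -> \bar R} :=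
  mscale k (pushforward lebesgue_measure g).
transitivity (\int[nu mg]_x f x)%E.
  apply: eq_measure_integral => A mA _.
  exact: (lebesgue_measure_affine _ a b).
rewrite ge0_integral_mscale//=; congr (_ * _)%E.
by rewrite ge0_integral_pushforward.
Qed.

(** The normal law is defined through its values on sets, so its density enters
    integrals as a Radon-Nikodym derivative.  The bounds make f integrable for
    any parameters of the law. *)
Lemma integral_normal_prob (R : realType) (m s : R) (f : R -> \bar R) :
  measurable_fun setT f -> (forall x, 0 <= f x <= 1)%E ->
  (\int[normal_prob m s]_x f x
   = \int[lebesgue_measure]_x (f x * (normal_pdf m s x)%:E))%E.
Proof.
move=> mf f01.
have nl : normal_prob m s `<< @lebesgue_measure R := normal_prob_dominates m s.
have fint : (normal_prob m s).-integrable setT f.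
  apply/integrableP; split=> //.
  apply: (@le_lt_trans _ _ (\int[normal_prob m s]_x cst 1 x)%E).
    apply: ge0_le_integral => //=; first exact: measurableT_comp.
    by move=> x _; have /andP[f0 f1] := f01 x; rewrite gee0_abs.
  by rewrite integral_cst//= mul1e probability_setT ltry.
have mpdf : measurable_fun setT (fun x => (normal_pdf m s x)%:E).
  by apply/measurable_EFinP; exact: measurable_normal_pdf.
rewrite -(Radon_Nikodym_change_of_variables nl)//.
have RNint : lebesgue_measure.-integrable setT
    (Radon_Nikodym (charge_of_finite_measure (normal_prob m s))
      lebesgue_measure).
  exact: Radon_Nikodym_integrable.
have mRN := measurable_int _ RNint.
apply: ae_eq_integral => //.
- exact: emeasurable_funM.
- exact: emeasurable_funM.
- apply: ae_eqe_mul2l; apply: integral_ae_eq => // E _ mE.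
  by rewrite -Radon_Nikodym_integral.
Qed.

Lemma measurable_preimage_affine (R : realType) (a b : R) (B : set R) :
  measurable B -> measurable [set x : R | B (a * x + b)].
Proof.
move=> mB; rewrite -[X in measurable X]setTI.
exact: (measurable_affine _ a b).
Qed.

Lemma normal_prob_indic (R : realType) (m s : R) (B : set R) :
  measurable B ->
  normal_prob m s B
    = (\int[lebesgue_measure]_x (\1_B x * normal_pdf m s x)%:E)%E.
Proof.
move=> mB; transitivity (\int[normal_prob m s]_x (\1_B x)%:E)%E.
  by rewrite integral_indic// setIT.
rewrite integral_normal_prob//; last first.
  by move=> x; rewrite !lee_fin indicE; case: (_ \in _); rewrite !lexx ?ler01.
by apply/measurable_EFinP.
Qed.

Lemma measurable_indic_normal_pdf (R : realType) (m s : R) (B : set R) :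
  measurable B ->
  measurable_fun setT (fun x => (\1_B x * normal_pdf m s x)%:E).
Proof.
by move=> mB; apply/measurable_EFinP/measurable_funM => //;
  exact: measurable_normal_pdf.
Qed.

(** For x t >= 0, (x + t)^2 >= x^2 + t^2, so shifting by t multiplies the centred
    density by at most exp (- t^2 / (2 s^2)). *)
Lemma normal_prob_translate_le (R : realType) (s t : R) (B C : set R) :
  s != 0 -> measurable B -> measurable C ->
  (forall x, B (x + t) -> 0 <= x * t /\ C x) ->
  (normal_prob 0 s B
    <= (expR (- t ^+ 2 / (s ^+ 2 *+ 2)))%:E * normal_prob 0 s C)%E.
Proof.
move=> s0 mB mC BC; rewrite !normal_prob_indic//.
rewrite (ge0_integral_affine _ 1 t) ?oner_eq0//; last 2 first.
- exact: measurable_indic_normal_pdf.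
- by move=> x; rewrite lee_fin mulr_ge0// normal_pdf_ge0.
rewrite normr1 mul1e -ge0_integralZl//; last 2 first.
- exact: measurable_indic_normal_pdf.
- by move=> x _; rewrite lee_fin mulr_ge0// normal_pdf_ge0.
apply: ge0_le_integral => //=.
- by move=> x _; rewrite lee_fin mulr_ge0// normal_pdf_ge0.
- apply: (measurableT_comp (measurable_indic_normal_pdf _ 0 s _ mB)) => //.
  exact: measurable_affine.
- apply: emeasurable_funM => //; exact: measurable_indic_normal_pdf.
move=> x _; rewrite -EFinM lee_fin mul1r !indicE !normal_pdfE//.
have [/set_mem/BC[xt /mem_set ->]|_] := boolP (x + t \in B); last first.
  rewrite mul0r !mulr_ge0 ?expR_ge0 ?normal_peak_ge0//.
rewrite !mul1r mulrCA ler_wpM2l ?normal_peak_ge0// /normal_fun -expRD ler_expR.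
rewrite !subr0 -mulrDl ler_wpM2r ?invr_ge0 ?mulrn_wge0 ?sqr_ge0//.
by rewrite sqrrD; lra.
Qed.

(** Each of the half-lines beyond t and - t is translated to the half-line from
    0; these two have total mass at most 1, which is why no factor 2 appears. *)
Lemma normal_prob_tail (R : realType) (s t : R) :
  s != 0 -> 0 <= t ->
  (normal_prob 0 s [set x : R | t < `|x|]%R
    <= (expR (- t ^+ 2 / (s ^+ 2 *+ 2)))%:E)%E.
Proof.
move=> s0 t0; set k := expR _.
have -> : [set x : R | t < `|x|] = `]t, +oo[ `|` `]-oo, - t[.
  apply/seteqP; split=> x /=; rewrite !in_itv/= andbT lter_normr ltrNr.
    by move=> /orP[|]; [left|right].
  by move=> [->|->]; rewrite ?orbT.
rewrite measureU//; last first.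
  apply/seteqP; split=> x //= []; rewrite !in_itv/= andbT; lra.
have hR : (normal_prob 0 s `]t, +oo[ <= k%:E * normal_prob 0 s `]0%R, +oo[)%E.
  apply: normal_prob_translate_le => // x /=; rewrite !in_itv/= !andbT.
  by rewrite ltrDr => x0; split=> //; rewrite mulr_ge0// ltW.
have hL : (normal_prob 0 s `]-oo, (- t)%R[ <=
    k%:E * normal_prob 0 s `]-oo, 0%R[)%E.
  rewrite /k -sqrrN; apply: normal_prob_translate_le => // x /=.
  by rewrite !in_itv/= gtrDr => x0; split=> //; nra.
apply: (le_trans (leeD hR hL)).
rewrite -ge0_muleDr// -measureU//; last first.
  apply/seteqP; split=> x //= []; rewrite !in_itv/= andbT; lra.
rewrite -[leRHS]mule1 lee_wpmul2l ?lee_fin ?expR_ge0// probability_le1//.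
exact: measurableU.
Qed.

(** Completing the square in x:
    (z - s x)^2 / t^2 + x^2 = z^2 / r^2 + (r x / t - s z / (r t))^2
    when r^2 = s^2 + t^2. *)
Lemma normal_pdf_rotate (R : realType) (sigma s t r x z : R) :
  sigma != 0 -> t != 0 -> r != 0 -> r ^+ 2 = s ^+ 2 + t ^+ 2 ->
  normal_pdf 0 sigma ((z - s * x) / t) * normal_pdf 0 sigma x
   = normal_pdf 0 sigma (z / r)
     * normal_pdf 0 sigma (r / t * x - s * z / (r * t)).
Proof.
move=> sg0 t0 r0 hr; rewrite !normal_pdfE// [LHS]mulrACA [RHS]mulrACA; congr (_ * _).
rewrite /normal_fun -!expRD; congr expR.
rewrite !subr0 -!mulrDl; congr (_ / _).
rewrite -!opprD; congr (- _).
have -> : (z / r) ^+ 2 + (r / t * x - s * z / (r * t)) ^+ 2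
    = (z ^+ 2 * t ^+ 2 + (r ^+ 2 * x - s * z) ^+ 2) / (r ^+ 2 * t ^+ 2).
  by field; rewrite r0 t0.
have r20 : s ^+ 2 + t ^+ 2 != 0 by rewrite -hr expf_neq0.
by rewrite hr; field; rewrite t0 r20.
Qed.

(** The left-hand side is the law of s X + t Y for independent X and Y with law
    N(0, sigma^2).  The substitution z = s x + t y and Tonelli expose z as the
    outer variable; by [normal_pdf_rotate] the inner integral is that of a
    normal density, up to scaling.  Only the square of r is prescribed, so that
    r = s serves when t = 0 whatever the sign of s. *)
Lemma normal_prob_rotate (R : realType) (sigma s t : R) :
  sigma != 0 -> exists r, r ^+ 2 = s ^+ 2 + t ^+ 2 /\
  forall B : set R, measurable B ->
  (\int[normal_prob 0 sigma]_x normal_prob 0 sigma [set y | B (s * x + t * y)%R]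
   = normal_prob 0 sigma [set x | B (r * x)%R])%E.
Proof.
move=> sg0; have [->|t0] := eqVneq t 0.
  exists s; split=> [|B mB]; first by rewrite expr0n addr0.
  have mBs : measurable [set x | B (s * x)].
    rewrite -[X in measurable X]setTI.
    by apply: (measurable_funM (measurable_cst s) (@measurable_id _ _ _)).
  transitivity (\int[normal_prob 0 sigma]_x (\1_[set x | B (s * x)] x)%:E)%E;
    last by rewrite integral_indic// setIT.
  apply: eq_integral => x _; rewrite indicE.
  under eq_set do rewrite mul0r addr0.
  case: (boolP (_ \in _)) => [/set_mem/= Bx|/negP Bx].
    by rewrite (_ : [set _ | _] = setT) ?probability_setT//; apply/seteqP; split.
  rewrite (_ : [set _ | _] = set0) ?measure0//; apply/seteqP; split=> // _ /= ?.
  by apply: Bx; exact/mem_set.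
pose r := Num.sqrt (s ^+ 2 + t ^+ 2).
have r2 : r ^+ 2 = s ^+ 2 + t ^+ 2 by rewrite sqr_sqrtr// addr_ge0 ?sqr_ge0.
have r_gt0 : 0 < r.
  by rewrite sqrtr_gt0 ltr_wpDl ?sqr_ge0// exprn_even_gt0.
have r0 : r != 0 by rewrite gt_eqF.
exists r; split=> // B mB.
pose phi := normal_pdf 0 sigma.
have mphi : measurable_fun setT phi by exact: measurable_normal_pdf.
have phi0 x : 0 <= phi x by exact: normal_pdf_ge0.
pose E := [set xy : R * R | B (s * xy.1 + t * xy.2)].
have mE : measurable E.
  rewrite -[X in measurable X]setTI.
  apply: (_ : measurable_fun setT (fun xy : R * R => s * xy.1 + t * xy.2)) => //.
  by apply: measurable_funD; apply: measurable_funM.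
(* The joint density of (X, s X + t Y), restricted to values of the second
   coordinate in B. *)
pose f (xz : R * R) : R := `|t|^-1 *
  (\1_B xz.2 * phi ((xz.2 - s * xz.1) / t) * phi xz.1).
have f0 xz : 0 <= f xz by rewrite !mulr_ge0 ?invr_ge0.
have mf : measurable_fun setT (EFin \o f).
  apply/measurable_EFinP; apply: measurable_funM => //.
  apply: measurable_funM; last exact: measurableT_comp.
  apply: measurable_funM; first exact: measurableT_comp.
  apply: (measurableT_comp mphi); apply: measurable_funM => //.
  by apply: measurable_funB => //; exact: measurable_funM.
have mEx x : measurable [set y | B (s * x + t * y)].
  rewrite (_ : [set _ | _] = [set y | B (t * y + s * x)]).
    exact: measurable_preimage_affine.
  by apply/seteqP; split=> y /=; rewrite addrC.
transitivity (\int[lebesgue_measure]_x \int[lebesgue_measure]_z (f (x, z))%:E)%E.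
  rewrite integral_normal_prob; last 2 first.
  - have := measurable_fun_xsection (normal_prob 0 sigma) mE.
    by congr (measurable_fun _ _); apply/funext => x /=; rewrite xsectionE.
  - by move=> x; rewrite measure_ge0/= probability_le1 //; exact: mEx.
  apply: eq_integral => x _; rewrite normal_prob_indic//.
  rewrite (ge0_integral_affine _ t^-1 (- (s * x / t))); last 3 first.
  - by rewrite invr_eq0.
  - exact: measurable_indic_normal_pdf.
  - by move=> y; rewrite lee_fin mulr_ge0.
  have mg : measurable_fun setT (fun z : R =>
      (\1_[set y | B (s * x + t * y)] (t^-1 * z + - (s * x / t)) *
       normal_pdf 0 sigma (t^-1 * z + - (s * x / t)))%:E).
    apply: (measurableT_comp (measurable_indic_normal_pdf _ 0 sigma _ (mEx x))) => //.
    exact: measurable_affine.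
  rewrite -ge0_integralZl//; last first.
    by move=> y _; rewrite lee_fin mulr_ge0// phi0.
  rewrite -ge0_integralZr//; last 3 first.
  - exact: measurable_funeM.
  - by move=> y _; rewrite mule_ge0// lee_fin mulr_ge0// phi0.
  - by rewrite lee_fin phi0.
  apply: eq_integral => z _.
  rewrite -!EFinM; congr EFin; rewrite /f/= normfV -!mulrA; congr (_ * _).
  have -> : t^-1 * z - s * (x / t) = (z - s * x) / t by field.
  congr (_ * _); transitivity (\1_B (s * x + t * ((z - s * x) / t)) : R) => //.
  by congr (\1_B _); field.
transitivity (\int[lebesgue_measure]_z \int[lebesgue_measure]_x (f (x, z))%:E)%E.
  apply: (@fubini_tonelli _ _ (measurableTypeR R) (measurableTypeR R) R
    lebesgue_measure lebesgue_measure (EFin \o f)) => //.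
transitivity (\int[lebesgue_measure]_z (r^-1 * (\1_B z * phi (z / r)))%:E)%E.
  apply: eq_integral => z _.
  under eq_integral => x _.
    rewrite /f/= -(mulrA (\1_B z)) (normal_pdf_rotate _ _ _ _ r)//.
    rewrite [X in X%:E](_ : _ = `|t|^-1 * (\1_B z * phi (z / r)) *
      phi (r / t * x + - (s * z / (r * t)))); last by rewrite /phi; ring.
    rewrite EFinM; over.
  rewrite ge0_integralZl//; last 3 first.
  - apply: (measurableT_comp (f := EFin \o phi)); first exact/measurable_EFinP.
    exact: measurable_affine.
  - by move=> x _; rewrite lee_fin.
  - by rewrite lee_fin !mulr_ge0// invr_ge0.
  have := integral_normal_pdf 0 sigma.
  rewrite (ge0_integral_affine _ (r / t) (- (s * z / (r * t)))); last 3 first.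
  - by rewrite mulf_neq0// invr_eq0.
  - exact/measurable_EFinP.
  - by move=> x; rewrite lee_fin.
  rewrite -/phi; set I := (\int[_]_x _)%E => hI.
  have -> : I = (`|t| / r)%:E.
    have rt : `|r / t| != 0 by rewrite normr_eq0 mulf_neq0// invr_eq0.
    have -> : I = (`|r / t|^-1%:E * (`|r / t|%:E * I))%E.
      by rewrite muleA -EFinM mulVf// mul1e.
    by rewrite hI mule1 normrM normfV (gtr0_norm r_gt0) invfM invrK mulrC.
  rewrite -EFinM; congr EFin; field.
  by rewrite r0 normr_eq0.
have mBr : measurable [set x | B (r * x)].
  have := measurable_preimage_affine _ r 0 _ mB.
  by under eq_set do rewrite addr0.
rewrite [in RHS]normal_prob_indic//.
rewrite [RHS](ge0_integral_affine _ r^-1 0); last 3 first.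
- by rewrite invr_eq0.
- exact: measurable_indic_normal_pdf.
- by move=> x; rewrite lee_fin mulr_ge0// phi0.
rewrite -ge0_integralZl//; last 2 first.
- apply: (measurableT_comp (measurable_indic_normal_pdf _ 0 sigma _ mBr)) => //.
  exact: measurable_affine.
- by move=> x _; rewrite lee_fin mulr_ge0// phi0.
apply: eq_integral => z _; rewrite -EFinM; congr EFin.
rewrite addr0 normfV gtr0_norm// [r^-1 * z]mulrC; congr (_ * (_ * _)).
transitivity (\1_B (r * (z / r)) : R); first by congr (\1_B _); field.
by [].
Qed.

(** * Linear combinations of independent Gaussians *)

Lemma measurable_cylinder (d : measure_display) (T : measurableType d)
    (R : realType) (P : probability T R) (n : nat) (eps : 'I_n -> {RV P >-> R})
    (J : {set 'I_n}) (C : 'I_n -> set R) :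
  (forall i, measurable (C i)) ->
  measurable (\bigcap_(i in [set` J]) (eps i @^-1` C i)).
Proof.
move=> mC; apply: fin_bigcap_measurable => [|i _]; first exact: finite_finset.
exact: measurable_funPTI.
Qed.

(** Conditionally on F, the hypothesis says that S and U are independent with
    the laws of s X and X, where X is N(0, sigma^2).  Since a product measure is
    determined by rectangles, the conditional law of (S, U) is this product, and
    the law of S + a U is computed by sections. *)
Lemma normal_convolution (d : measure_display) (T : measurableType d)
    (R : realType) (P : probability T R) (sigma s a : R) (S U : T -> R)
    (F : set T) (B : set R) :
  measurable_fun setT S -> measurable_fun setT U -> measurable F ->
  measurable B ->
  (forall B1 B2 : set R, measurable B1 -> measurable B2 ->
    P ([set w | B1 (S w)] `&` [set w | B2 (U w)] `&` F)
     = normal_prob 0 sigma [set x | B1 (s * x)%R] * normal_prob 0 sigma B2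
       * P F)%E ->
  (P ([set w | B (S w + a * U w)%R] `&` F)
   = \int[normal_prob 0 sigma]_x normal_prob 0 sigma [set y | B (s * x + a * y)%R]
     * P F)%E.
Proof.
move=> mS mU mF mB SUF.
have mSaU : measurable_fun setT (fun w => S w + a * U w).
  by apply: measurable_funD => //; exact: measurable_funM.
have mBS : measurable [set w | B (S w + a * U w)].
  by rewrite -[X in measurable X]setTI; exact: mSaU.
(* Conditioning on F divides by P F. *)
have [PF0|PF0] := eqVneq (P F) 0%E.
  rewrite PF0 mule0; apply/eqP; rewrite eq_le measure_ge0 andbT -PF0.
  by apply: le_measure; rewrite ?inE//; exact: measurableI.
have PF_fin : P F \is a fin_num by exact: fin_num_measure.
have p_gt0 : 0 < fine (P F).
  by rewrite fine_gt0// lt0e PF0 measure_ge0/= ltey_eq PF_fin.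
have k_ge0 : 0 <= (fine (P F))^-1 by rewrite invr_ge0 ltW.
pose h w : R * measurableTypeR R := (S w, U w).
have mh : measurable_fun setT h by exact: measurable_fun_pair.
pose m' : {measure set (R * measurableTypeR R) -> \bar R} :=
  mscale (NngNum k_ge0) (pushforward (mrestr P mF) h).
have mlin : measurable_fun setT (fun x : measurableTypeR R => s * x : R).
  exact: measurable_funM.
pose lin_mixin := isMeasurableFun.Build _ _ _ _ _ mlin.
pose lin : {RV (normal_prob 0 sigma) >-> R} :=
  HB.pack (fun x : R => s * x) lin_mixin.
pose m1 := distribution (normal_prob 0 sigma) lin.
pose E := [set xy : R * measurableTypeR R | B (xy.1 + a * xy.2)].
have mE : measurable E.
  rewrite -[X in measurable X]setTI.
  apply: (_ : measurable_fun setT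
    (fun xy : R * measurableTypeR R => xy.1 + a * xy.2)) => //.
  by apply: measurable_funD => //; apply: measurable_funM.
have m'E : ((m1 \x normal_prob 0 sigma) E = m' mh E)%E.
  apply: product_measure_unique => // B1 B2 mB1 mB2.
  rewrite /m'/= /mscale/= /mrestr /pushforward/=.
  rewrite (_ : _ @^-1` _ = [set w | B1 (S w)] `&` [set w | B2 (U w)])//.
  by rewrite SUF//= -[P F in LHS]fineK// muleCA -EFinM mulVf ?gt_eqF// mule1.
have -> : P ([set w | B (S w + a * U w)] `&` F) = (m' mh E * P F)%E.
  rewrite /m'/= /mscale/= /mrestr /pushforward/= -[X in (_ * _ * X)%E]fineK//.
  by rewrite muleAC -EFinM mulVf ?gt_eqF// mul1e.
rewrite -m'E; congr (_ * _)%E.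
rewrite /product_measure1/= ge0_integral_distribution//=; last first.
  exact: measurable_fun_xsection.
by apply: eq_integral => x _; rewrite /= xsectionE.
Qed.

(** The linear combination over I has the law of r X for one Gaussian X, with r^2
    the sum of the squared coefficients.  Carrying the events on the coordinates
    J outside I through the induction replaces any discussion of independence
    between a partial sum and the next coordinate: when i is moved into the sum,
    the event on i becomes the second side of a rectangle. *)
Lemma normal_linear_combination (d : measure_display) (T : measurableType d)
    (R : realType) (P : probability T R) (n : nat) (eps : 'I_n -> {RV P >-> R})
    (sigma : R) (a : 'I_n -> R) (I : {set 'I_n}) :
  sigma != 0 -> iid_normal eps sigma ->
  exists r, r ^+ 2 = \sum_(i in I) a i ^+ 2 /\
  forall (J : {set 'I_n}) (C : 'I_n -> set R) (B : set R),
    [disjoint I & J]%B -> (forall i, measurable (C i)) -> measurable B ->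
    (P ([set w | B (\sum_(i in I) a i * eps i w)%R]
        `&` \bigcap_(i in [set` J]) (eps i @^-1` C i))
     = normal_prob 0 sigma [set x | B (r * x)%R]
       * P (\bigcap_(i in [set` J]) (eps i @^-1` C i)))%E.
Proof.
move=> sg0 [indep law].
elim: {I}#|I| {-2}I (erefl #|I|) => [|k IH] I.
  move=> /cards0_eq ->; exists 0; split=> [|J C B _ mC mB].
    by rewrite big_set0 expr0n.
  under eq_set do rewrite big_set0.
  under [X in normal_prob _ _ X]eq_set do rewrite mul0r.
  have [B0|B0] := pselect (B 0).
    rewrite [X in P (X `&` _)](_ : _ = setT); last by apply/seteqP; split.
    rewrite [X in normal_prob _ _ X](_ : _ = setT); last by apply/seteqP; split.
    by rewrite setTI probability_setT mul1e.
  rewrite [X in P (X `&` _)](_ : _ = set0); last by apply/seteqP; split.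
  rewrite [X in normal_prob _ _ X](_ : _ = set0); last by apply/seteqP; split.
  by rewrite set0I !measure0 mul0e.
move=> Ik; have /card_gt0P[i iI] : (0 < #|I|)%N by rewrite Ik.
have [|r' [r'2 lawS]] := IH (I :\ i)%SET.
  by move: Ik; rewrite (cardsD1 i) iI add1n => -[].
have [r [r2 rot]] := normal_prob_rotate _ _ r' (a i) sg0.
exists r; split=> [|J C B IJ mC mB].
  by rewrite r2 r'2 [in RHS](big_setD1 i)//= addrC.
set F := \bigcap_(_ in _) _.
have mF : measurable F by exact: measurable_cylinder.
pose S w := \sum_(j in (I :\ i)%SET) a j * eps j w.
have mS : measurable_fun setT S.
  rewrite (_ : S = fun w => \sum_(j <- enum (I :\ i)%SET) a j * eps j w).
    by apply: measurable_sum => j; exact: measurable_funM.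
  by apply/funext => w; rewrite big_enum.
under eq_set do rewrite (big_setD1 i)//= addrC -/(S _).
rewrite (normal_convolution _ _ _ _ sigma r')//; first by rewrite rot.
move=> B1 B2 mB1 mB2.
(* The rectangle constraint on coordinate i joins those on J. *)
pose C' j := if j == i then B2 else C j.
have mC' j : measurable (C' j) by rewrite /C'; case: ifP.
have iJ : i \notin J by rewrite (disjointFr IJ iI).
have capE : \bigcap_(j in [set` (i |: J)%SET]) (eps j @^-1` C' j)
    = [set w | B2 (eps i w)] `&` F.
  apply/seteqP; split=> w.
    move=> Cw; split; first by have := Cw i; rewrite /C'/= eqxx; apply; exact: setU11.
    move=> j /= jJ; have := Cw j; rewrite /C'/= ifN; first by apply; exact: setU1r.
    by apply: contraNneq iJ => <-.
  move=> [/= B2w Fw] j /=; rewrite /C' in_setU1; case: eqVneq => [->//|_] /= jJ.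
  exact: Fw.
rewrite -setIA -capE lawS//; last first.
  rewrite disjoint_subset; apply/fintype.subsetP => j; rewrite !inE => /andP[ji jI].
  rewrite negb_or ji/=.
  by rewrite (disjointFr IJ jI).
rewrite -muleA; congr (_ * _)%E.
rewrite indep// big_setU1//= {1}/C' eqxx; congr (_ * _)%E.
  by rewrite -(law i).
rewrite indep//; apply: eq_bigr => j jJ.
by rewrite /C' ifN//; apply: contraNneq iJ => <-.
Qed.

(** * Tail of the noise and the error bounds *)

Lemma measurable_deviation (d : measure_display) (T : measurableType d)
    (R : realType) (P : probability T R) (n : nat) (eps : 'I_n -> {RV P >-> R})
    (a : 'I_n -> R) (t : R) :
  measurable [set w | t < `|\sum_(i < n) a i * eps i w|].
Proof.
have mS : measurable_fun setT (fun w => `|\sum_(i < n) a i * eps i w|).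
  apply: measurableT_comp => //; apply: measurable_sum => i.
  exact: measurable_funM.
rewrite (_ : [set _ | _] =
    (fun w => `|\sum_(i < n) a i * eps i w|) @^-1` `]t, +oo[%classic).
  by rewrite -[X in measurable X]setTI; exact: mS.
by apply/seteqP; split=> w /=; rewrite in_itv/= andbT.
Qed.

(** The threshold is (2 L)^(1/2) standard deviations, so [normal_prob_tail] gives
    exactly exp (- L).  When all coefficients vanish the event is empty, which
    the strict inequality takes care of. *)
Lemma linear_noise_tail (d : measure_display) (T : measurableType d)
    (R : realType) (P : probability T R) (n : nat) (eps : 'I_n -> {RV P >-> R})
    (sigma : R) (a : 'I_n -> R) (L : R) :
  0 < sigma -> iid_normal eps sigma -> 0 <= L ->
  (P [set w | sigma * Num.sqrt (2 * L * \sum_(i < n) a i ^+ 2)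
              < `|\sum_(i < n) a i * eps i w|]%R <= (expR (- L))%:E)%E.
Proof.
move=> sg0 heps L0; set t := sigma * _.
have sgn0 : sigma != 0 by rewrite gt_eqF.
have [r [r2 law]] :=
  normal_linear_combination _ _ _ _ _ _ _ a [set: 'I_n]%SET sgn0 heps.
have r2' : r ^+ 2 = \sum_(i < n) a i ^+ 2.
  by rewrite r2; apply: eq_bigl => i; rewrite inE.
have tE : t = sigma * Num.sqrt (2 * L) * `|r|.
  by rewrite /t -r2' sqrtrM ?mulr_ge0// sqrtr_sqr mulrA.
have mB (u : R) : measurable [set x : R | u < `|x|].
  have mn : measurable_fun setT (fun x : R => `|x|) by exact: measurableT_comp.
  rewrite (_ : [set _ | _] = (fun x : R => `|x|) @^-1` `]u, +oo[%classic).
    by rewrite -[X in measurable X]setTI; exact: mn.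
  by apply/seteqP; split=> x /=; rewrite in_itv/= andbT.
have noC : \bigcap_(i in [set` (finset.set0 : {set 'I_n})]) (eps i @^-1` setT) = setT.
  by apply/seteqP; split.
(* All coordinates are in the sum, none is left to constrain. *)
have := law finset.set0 (fun=> setT) [set x | t < `|x|].
rewrite noC setIT probability_setT mule1.
have sumT w : \sum_(i in [set: 'I_n]%SET) a i * eps i w = \sum_(i < n) a i * eps i w.
  by apply: eq_bigl => i; rewrite inE.
rewrite (_ : [set w | [set x | _] _] = [set w | t < `|\sum_(i < n) a i * eps i w|]);
  last by apply/funext => w /=; rewrite sumT.
move=> ->//; last by rewrite disjoint_sym; apply/pred0P => i /=; rewrite inE.
apply: (@le_trans _ _ (normal_prob 0 sigma
    [set x : R | sigma * Num.sqrt (2 * L) < `|x|]%R)).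
  apply: le_measure; rewrite ?inE//.
    have := measurable_preimage_affine _ r 0 _ (mB t).
    by under eq_set do rewrite addr0.
    exact: mB.
  move=> x /=; rewrite tE normrM mulrC.
  have := normr_ge0 r; rewrite le_eqVlt => /predU1P[<-|r_gt0].
    by rewrite !mul0r ltxx.
  by rewrite ltr_pM2l.
apply: (le_trans (normal_prob_tail _ _ _ sgn0 _)).
  by rewrite mulr_ge0 ?sqrtr_ge0// ltW.
rewrite lee_fin ler_expR exprMn sqr_sqrtr ?mulr_ge0//.
by rewrite le_eqVlt; apply/orP; left; apply/eqP; field.
Qed.

Lemma finite_union_bound (d : measure_display) (T : measurableType d)
    (R : realType) (mu : {measure set T -> \bar R}) (I : finType)
    (F : I -> set T) :
  (forall i, measurable (F i)) ->
  (mu (\bigcup_i F i) <= \sum_(i : I) mu (F i))%E.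
Proof.
move=> mF; have -> : (\sum_(i : I) mu (F i) = \sum_(i \in [set: I]) mu (F i))%E.
  rewrite fsbig_seq ?index_enum_uniq//; apply: eq_fsbigl.
  by apply/seteqP; split=> // i _ /=; rewrite mem_index_enum.
apply: content_sub_fsum => //; first exact: finite_finset.
by apply: fin_bigcup_measurable => //; exact: finite_finset.
Qed.

Theorem theorem3p3 (R : realType) (d : measure_display) (T : measurableType d)
    (P : probability T R) (n p q : nat) (hp : (0 < p)%N)
    (X : 'M[R]_(n, p))
    (hX : forall j : 'I_p, ((col j X)^T *m col j X) 0 0 / n%:R = 1)
    (betastar : 'cV[R]_p)
    (sigma : R) (hsigma : 0 < sigma)
    (eps : 'I_n -> {RV P >-> R}) (heps : iid_normal eps sigma)
    (Y : T -> 'cV[R]_n)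
    (hY : forall w : T, Y w = X *m betastar + \col_(i < n) eps i w)
    (G : 'M[R]_p) (hG : tilde_inverse (gram X) G)
    (A : 'M[R]_(q, p)) (hA : ker A = ker X)
    (c : R) (hH : assumption_H n betastar G A 3 c)
    (eta : R) (heta0 : 0 < eta) (heta1 : eta < 1)
    (lambda : R)
    (hlambda : lambda = 2 * sigma * Num.sqrt (2 * n%:R * ln (p%:R / eta)))
    (betahat : T -> 'cV[R]_p)
    (hbetahat : forall w : T,
       is_minimizer (objective X G A lambda (Y w)) (betahat w)) :
  holds_with_prob_ge P (1 - eta)
    [set w : T |
      l2norm (A *m (betahat w - betastar)) ^+ 2
        <= 72 * sigma ^+ 2 / c * ln (p%:R / eta)
             * \sum_(j < p | betastar j 0 != 0) xi n G A j
      /\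
      l1norm (Xi n G A *m (betahat w - betastar))
        <= 24 * Num.sqrt 2 * sigma / c * Num.sqrt (ln (p%:R / eta) / n%:R)
             * \sum_(j < p | betastar j 0 != 0) xi n G A j].
Proof.
(* For n = 0 the normalization of the columns would read 0 / 0 = 1. *)
have n0 : (0 < n)%N.
  rewrite lt0n; apply/eqP => n0; have := hX (Ordinal hp).
  rewrite (_ : n%:R = 0); last by rewrite n0.
  by rewrite invr0 mulr0 => /esym/eqP; rewrite oner_eq0.
have nr0 : 0 < n%:R :> R by rewrite ltr0n.
have pr0 : 0 < p%:R :> R by rewrite ltr0n.
have c0 : 0 < c by case: hH.
set L := ln (p%:R / eta) in hlambda *.
have L0 : 0 < L.
  by rewrite ln_gt0// ltr_pdivlMr// mul1r (lt_le_trans heta1)// ler1n.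
have lam0 : 0 < lambda by rewrite hlambda !mulr_gt0// sqrtr_gt0 !mulr_gt0.
pose Z := X *m G *m gram A.
have xiZ j : xi n G A j = n%:R^-1 * \sum_(i < n) Z i j ^+ 2 by exact: xiE.
have xi0 j : 0 <= xi n G A j by exact: (xi_ge0 _ _ _ _ X).
(* lambda is chosen for the thresholds of the noise to be those of the tail
   bound with L = ln (p / eta). *)
have thrE j : sigma * Num.sqrt (2 * L * \sum_(i < n) Z i j ^+ 2)
    = lambda / 2 * Num.sqrt (xi n G A j).
  have -> : \sum_(i < n) Z i j ^+ 2 = n%:R * xi n G A j.
    by rewrite xiZ mulrA divff ?mul1r// gt_eqF.
  rewrite hlambda (_ : 2 * sigma * _ / 2 = sigma * Num.sqrt (2 * n%:R * L));
    last by field.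
  rewrite -[RHS]mulrA -sqrtrM ?mulr_ge0 ?ltW//.
  by congr (_ * Num.sqrt _); ring.
pose F j := [set w | sigma * Num.sqrt (2 * L * \sum_(i < n) Z i j ^+ 2)
              < `|\sum_(i < n) Z i j * eps i w|].
have mF j : measurable (F j) by exact: measurable_deviation.
have PF j : (P (F j) <= (eta / p%:R)%:E)%E.
  apply: le_trans (linear_noise_tail _ _ _ _ _ _ _ _ _ hsigma heps (ltW L0)) _.
  by rewrite /L expRN lnK ?invf_div// posrE divr_gt0.
have mU : measurable (\bigcup_j F j).
  by apply: fin_bigcup_measurable => //; exact: finite_finset.
exists (~` (\bigcup_j F j)); split; first exact: measurableC.
- move=> w /= Ew.
  have hW j : `|\sum_(i < n) Z i j * eps i w| <= lambda / 2 * Num.sqrt (xi n G A j).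
    rewrite -thrE leNgt; apply/negP => Fj; apply: Ew.
    by exists j.
  have hWe j : `|\sum_(i < n) Z i j * (\col_i' eps i' w) i 0|
      <= lambda / 2 * Num.sqrt (xi n G A j).
    by under eq_bigr do rewrite mxE; exact: hW.
  have [predD l1D] := oracle_inequality _ _ _ _ _ _ _ _ _ _ _ _ _
    n0 lam0 hG hA (hY w) hH hWe (hbetahat w).
  have sxi0 : 0 <= \sum_(j < p | betastar j 0 != 0) xi n G A j by exact: sumr_ge0.
  split.
    apply: (le_trans predD); rewrite ler_wpM2r// hlambda exprMn sqr_sqrtr; last first.
      by rewrite !mulr_ge0// ltW.
    by rewrite le_eqVlt; apply/orP; left; apply/eqP; field; rewrite !gt_eqF.
  apply: (le_trans l1D); rewrite ler_wpM2r//.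
  have -> : lambda = 2 * Num.sqrt 2 * sigma * n%:R * Num.sqrt (L / n%:R).
    rewrite hlambda (_ : 2 * n%:R * L = 2 * (n%:R ^+ 2 * (L / n%:R))); last first.
      by field; rewrite gt_eqF.
    rewrite sqrtrM// sqrtrM ?sqr_ge0// sqrtr_sqr gtr0_norm//; ring.
  rewrite (_ : _ / (c * n%:R) =
      8 * (Num.sqrt 2 * sigma / c * Num.sqrt (L / n%:R))); last first.
    by field; rewrite !gt_eqF.
  rewrite -!mulrA ler_wpM2r ?ler_nat//.
  by rewrite !mulr_ge0 ?sqrtr_ge0 ?invr_ge0// ltW.
rewrite probability_setC// EFinB leeB//.
apply: (le_trans (finite_union_bound _ _ _ P _ _ mF)).
apply: (@le_trans _ _ (\sum_(j < p) (eta / p%:R)%:E)%E).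
  by apply: lee_sum => j _; exact: PF.
by rewrite sumEFin sumr_const card_ord -(mulr_natr (eta / _)) divfK ?gt_eqF//.
Qed.
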